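(* $$\frac{n^{2/3}}{(\log n)^{4/3}}\ll f_{9,3}(n)-\pi(n)\ll n^{2/3}\log n.$$
   Context: $\log$ is the natural logarithm, $\pi(n)$ is the number of primes not exceeding $n$. $X\ll Y$ (for positive quantities depending on $n$) means there is an absolute constant $c>0$ with $X\le cY$ for all sufficiently large $n$. $f_{k,d}(n)$ is the maximal size of a set $A\subseteq\{1,\dots,n\}$ such that the equation $a_1a_2\cdots a_k=x^d$ (with $a_1,\dots,a_k\in A$ not necessarily distinct, $x$ an integer) has no solution except trivial ones, where a solution is trivial if the multiset $\{a_1,\dots,a_k\}$ can be partitioned into $d$-element sub-multisets each consisting of $d$ copies of the same number (e.g. $a^3b^3c^3=x^3$ for $k=9,d=3$). *)

(* Defs.v *)
From HB Require Import structures.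
From mathcomp Require Import all_boot all_order all_algebra.
From mathcomp Require Import all_classical all_reals all_analysis.
Set Implicit Arguments.
Unset Strict Implicit.
Unset Printing Implicit Defensive.
Import Order.TTheory GRing.Theory Num.Theory.
Import numFieldNormedType.Exports.
Local Open Scope classical_set_scope.
Local Open Scope ring_scope.

(* The multiset underlying [a] is the union of blocks, each made of [d] copies
   of one number; a number may occur in several blocks of the list [bs]. *)
Definition trivial_solution (T : eqType) (d : nat) (a : seq T) : Prop :=
  exists bs : seq T, perm_eq a (flatten [seq nseq d b | b <- bs]).

(* Subsets of {0, ..., n} are encoded as {set 'I_n.+1}. *)
Definition only_trivial_solutions (k d n : nat) (A : {set 'I_n.+1}) : Prop :=
  forall (a : k.-tuple 'I_n.+1) (x : int),
    (forall i : 'I_k, tnth a i \in A) ->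
    \prod_(i < k) (tnth a i : nat)%:Z = x ^+ d ->
    trivial_solution d a.

Definition admissible (k d n : nat) (A : {set 'I_n.+1}) : Prop :=
  (forall i, i \in A -> (0 < i)%N) /\ only_trivial_solutions k d A.

(* The empty set is always admissible, so the maximum is attained. *)
Definition max_size (k d n : nat) : nat :=
  \max_(A : {set 'I_n.+1} | `[< admissible k d A >]) #|A|.

Definition prime_count (n : nat) : nat := #|[set p : 'I_n.+1 | prime p]|.

Definition vinogradov (R : realType) (X Y : nat -> R) : Prop :=
  exists2 c : R, 0 < c & \forall n \near \oo, X n <= c * Y n.

(* Main.v *)
(* Upper bound: writing m in A with m^3 > n as m = u v, where u is the least divisor
   of m with u^3 > n (so u <= n^(2/3) or u is prime), turns A into a bipartite graph
   on the pairs (u, v). A 4-cycle or a 6-cycle is an identity a1 a2 a3 = b1 b2 b3, and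
   then a1 a2 a3 (b1 b2 b3)^2 is a nontrivial cube, so the graph has neither. A graph
   of this kind between classes of sizes a and b has at most a + b + O((a b)^(2/3))
   edges; for u in [2^i, 2^(i+1)) we have v <= n / 2^i, so each of the O(log n) dyadic
   ranges of u contributes O(n^(2/3)) besides its own number of values u, and these
   add up to at most pi(n) + n^(2/3).

   Lower bound: take the primes in (sqrt n, n] and the products p q along the edges of
   a bipartite graph of girth 8 on the primes p, q <= sqrt n. In a product of nine such
   elements which is a cube, every vertex has weighted degree divisible by 3, and nine
   edges are too few for that unless all multiplicities are divisible by 3. Such graphs
   with N vertices and of the order of N^(4/3) edges exist over finite fields, and
   Chebyshev's estimate gives N of the order of sqrt n / log n. *)
Require Import Defs.
From HB Require Import structures.
From mathcomp Require Import all_boot all_order all_algebra.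
From mathcomp Require Import all_classical all_reals all_analysis.
From mathcomp Require Import all_field.
From mathcomp Require Import ring lra zify.
Import Order.TTheory GRing.Theory Num.Theory.
Import numFieldNormedType.Exports.
Local Open Scope classical_set_scope.
Local Open Scope set_scope.
Local Open Scope ring_scope.

(** * Trivial solutions and multiplicities *)

Lemma count_mem_flatten_nseq {T : eqType} (g : T -> nat) (s : seq T) (x : T) :
  count_mem x (flatten [seq nseq (g b) b | b <- s]) = (count_mem x s * g x)%N.
Proof.
elim: s => //= b s IHs; rewrite count_cat count_nseq IHs mulnDl /=.
by case: eqP => [->|].
Qed.

(** Blocks of d equal entries add multiples of d to each multiplicity; conversely the copies of each
    b are cut into blocks of d, which gives the witness. *)
Lemma trivial_solutionE {T : eqType} {d : nat} {a : seq T} : (0 < d)%N ->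
  trivial_solution d a <-> forall b, (d %| count_mem b a)%N.
Proof.
move=> d_gt0; split=> [[bs /permP abs] b | a_dvd].
  by rewrite abs (count_mem_flatten_nseq (fun=> d)) dvdn_mull.
exists (flatten [seq nseq (count_mem b a %/ d) b | b <- undup a]).
apply/allP => x _; rewrite /= (count_mem_flatten_nseq (fun=> d)).
rewrite (count_mem_flatten_nseq (fun b => count_mem b a %/ d)%N).
rewrite (count_uniq_mem _ (undup_uniq a)) mem_undup -mulnA divnK ?a_dvd //.
by case: (boolP (x \in a)) => [_|/count_memPn ->]; rewrite ?mul1n.
Qed.

(** * Edge weights in graphs without short cycles *)

Definition c4_free {X Y : Type} (E : X -> Y -> bool) : Prop :=
  forall x1 x2 y1 y2, E x1 y1 -> E x1 y2 -> E x2 y1 -> E x2 y2 ->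
  x1 <> x2 -> y1 <> y2 -> False.

Definition c6_free {X Y : Type} (E : X -> Y -> bool) : Prop :=
  forall x1 x2 x3 y1 y2 y3,
  E x1 y1 -> E x2 y1 -> E x2 y2 -> E x3 y2 -> E x3 y3 -> E x1 y3 ->
  x1 <> x2 -> x2 <> x3 -> x3 <> x1 -> y1 <> y2 -> y2 <> y3 -> y3 <> y1 -> False.

(** The substitute for minimal degree 2: at a vertex of weighted degree divisible by d, an edge of
    weight not divisible by d is continued by another one. *)
Lemma second_term_not_dvd {I : finType} {d : nat} {w : I -> nat} {i : I} :
  (d %| \sum_j w j)%N -> ~~ (d %| w i)%N -> exists2 j, j <> i & ~~ (d %| w j)%N.
Proof.
move=> d_sum d_wi; case: (pickP (fun j => (j != i) && ~~ (d %| w j)%N)).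
  by move=> j /andP[/eqP]; exists j.
move=> all_dvd; case/negP: d_wi; move: d_sum; rewrite (bigD1 i) //= dvdn_addl //.
by apply: dvdn_sum => j ji; move: (all_dvd j); rewrite ji => /negbFE.
Qed.

(* An edge with weight prime to 3 would lie in a subgraph of minimal degree 2,
   hence either on a 6-cycle or in a graph with four distinct vertices [y],
   each of weighted degree at least 3. *)
Lemma weights_dvd3 {X Y : finType} (E : X -> Y -> bool) (w : X -> Y -> nat) :
  c4_free E -> c6_free E -> (forall x y, (0 < w x y)%N -> E x y) ->
  (forall x, (3 %| \sum_y w x y)%N) -> (forall y, (3 %| \sum_x w x y)%N) ->
  (\sum_y \sum_x w x y < 12)%N ->
  forall x y, (3 %| w x y)%N.
Proof.
move=> c4 c6 wE wX wY w_small x1 y1; apply: contraT => w11.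
have nE x y : ~~ (3 %| w x y)%N -> E x y.
  by move=> h; apply: wE; rewrite lt0n; apply: contra h => /eqP ->.
(* The path y3 x2 y1 x1 y2 x3 y4 is grown in both directions from the edge x1 y1, all its weights
   being prime to 3. *)
have [y2 y21 w12] := second_term_not_dvd (wX x1) w11.
have [x2 x21 w21] := second_term_not_dvd (w := w ^~ y1) (wY y1) w11.
have [x3 x31 w32] := second_term_not_dvd (w := w ^~ y2) (wY y2) w12.
have [y3 y31 w23] := second_term_not_dvd (wX x2) w21.
have [y4 y42 w34] := second_term_not_dvd (wX x3) w32.
have x23 : x2 <> x3.
  move=> x23; rewrite -{}x23 in w32.
  by apply: (c4 x1 x2 y1 y2); [exact: nE..| | ] => /esym.
have y32 : y3 <> y2.
  move=> y32; rewrite {}y32 in w23.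
  by apply: (c4 x1 x2 y1 y2); [exact: nE..| | ] => /esym.
have y41 : y4 <> y1.
  move=> y41; rewrite {}y41 in w34.
  by apply: (c4 x1 x3 y1 y2); [exact: nE..| | ] => /esym.
have [y34|/eqP y34] := eqVneq y3 y4.
  rewrite -{}y34 in w34 *.
  by case: (c6 x2 x1 x3 y1 y2 y3); try exact: nE; auto.
move: w_small; rewrite ltnNge => /negP[].
have deg3 x y : ~~ (3 %| w x y)%N -> (3 <= \sum_x' w x' y)%N.
  move=> h; apply: dvdn_leq => //; rewrite (bigD1 x) //= addn_gt0.
  by rewrite lt0n; apply/orP; left; apply: contra h => /eqP ->.
have h1 := deg3 _ _ w11; have h2 := deg3 _ _ w12.
have h3 := deg3 _ _ w23; have h4 := deg3 _ _ w34.
rewrite (bigD1 y1) //= (bigD1 y2) /=; last by apply/eqP.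
rewrite (bigD1 y3) /=; last by apply/andP; split; apply/eqP.
rewrite (bigD1 y4) /=; last by apply/andP; split; [apply/andP; split|]; apply/eqP; auto.
lia.
Qed.

Lemma amgm3 {R : realFieldType} (p q : R) : 0 < p -> 0 < q -> 3 <= (p * q)^-1 + p + q.
Proof.
move=> p0 q0; have pq0 : 0 < p * q by rewrite mulr_gt0.
rewrite -(ler_pM2l pq0) !mulrDr divff ?gt_eqF //.
have [s3|s3] := lerP 3 (p + q).
  by have := ler_wpM2l (ltW pq0) s3; lra.
(* With s = p + q < 3, the two inequalities give 4 p q (3 - s) <= s^2 (3 - s) <= 4. *)
have h1 : 0 <= (p - q) ^+ 2 * (3 - (p + q)) by rewrite mulr_ge0 ?sqr_ge0; lra.
have h2 : 0 <= (p + q - 2) ^+ 2 * (p + q + 1) by rewrite mulr_ge0 ?sqr_ge0; lra.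
lra.
Qed.

(** * Edges of graphs without 4-cycles and 6-cycles *)

Section SparseGraph.
Context {X Y : finType} {E : {set X * Y}}.
Hypothesis c4 : c4_free (fun x y => (x, y) \in E).
Hypothesis c6 : c6_free (fun x y => (x, y) \in E).

Let dX (x : X) := #|[set e in E | e.1 == x]|.
Let dY (y : Y) := #|[set e in E | e.2 == y]|.

(* [p.1] is the middle edge of a path of length 3 whose endpoints are [p.2]. *)
Let is_path3 (p : (X * Y) * (X * Y)) :=
  [&& (p.2.1, p.1.2) \in E, (p.1.1, p.2.2) \in E, p.2.1 != p.1.1 & p.2.2 != p.1.2].

(** An edge xy is the middle of (deg x - 1)(deg y - 1) paths of length 3, and a path is determined
    by its endpoints, one in each class. *)
Lemma sum_path3_le :
  (\sum_(e in E) (dX e.1).-1 * (dY e.2).-1 <= #|fst @: E| * #|snd @: E|)%N.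
Proof.
rewrite -cardsX.
pose Q := [set p | (p.1 \in E) && is_path3 p].
have -> : (\sum_(e in E) (dX e.1).-1 * (dY e.2).-1)%N = #|Q|.
  rewrite -[#|Q|]sum1_card.
  transitivity (\sum_(p | (p.1 \in E) && is_path3 p) 1)%N; last first.
    by apply: eq_bigl => p; rewrite inE.
  rewrite -(pair_big_dep (mem E) (fun e f => is_path3 (e, f)) (fun _ _ => 1%N)) /=.
  apply: eq_bigr => -[x y] /= xyE.
  rewrite sum1_card mulnC.
  have -> : (dY y).-1 = #|[set x' | ((x', y) \in E) && (x' != x)]|.
    rewrite /dY (cardsD1 (x, y)) !inE xyE eqxx /=.
    rewrite -(card_imset _ (f := fun x' => (x', y))); last by move=> ? ? [].
    apply: eq_card => -[x' y']; rewrite !inE /=; apply/idP/imsetP.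
      case/and3P => ne h /eqP yy; rewrite yy in ne h *; exists x' => //.
      by rewrite inE h; apply: contra ne => /eqP ->.
    case=> z; rewrite inE => /andP[h ne] [-> ->].
    by rewrite h eqxx !andbT; apply: contra ne => /eqP[->].
  have -> : (dX x).-1 = #|[set y' | ((x, y') \in E) && (y' != y)]|.
    rewrite /dX (cardsD1 (x, y)) !inE xyE eqxx /=.
    rewrite -(card_imset _ (f := fun y' => (x, y'))); last by move=> ? ? [].
    apply: eq_card => -[x' y']; rewrite !inE /=; apply/idP/imsetP.
      case/and3P => ne h /eqP xx; rewrite xx in ne h *; exists y' => //.
      by rewrite inE h; apply: contra ne => /eqP ->.
    case=> z; rewrite inE => /andP[h ne] [-> ->].
    by rewrite h eqxx !andbT; apply: contra ne => /eqP[->].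
  rewrite -cardsX; apply: eq_card => -[x' y'].
  by rewrite /is_path3 !inE /= [RHS]unfold_in /= andbACA -andbA.
rewrite -(card_in_imset (f := snd) (D := mem Q)).
  apply/subset_leq_card/fintype.subsetP => -[x' y'] /imsetP[[[x y] [z t]]].
  rewrite inE /= => /andP[_ /and4P[/= h1 h2 _ _]] [-> ->]; rewrite inE /=.
  by apply/andP; split; apply/imsetP; [exists (z, y)|exists (x, t)].
move=> [[x1 y1] [x y]] [[x2 y2] [x' y']]; rewrite !inE /is_path3 /=.
move=> /andP[e1 /and4P[e2 e3 /eqP nx1 /eqP ny1]].
move=> /andP[f1 /and4P[f2 f3 /eqP nx2 /eqP ny2]] [xx yy].
rewrite -{}xx -{}yy in f2 f3 nx2 ny2 *.
(* Two paths with the same ends that share exactly one inner vertex enclose a 4-cycle; sharing none,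
   they form a 6-cycle. *)
have [y12|/eqP y12] := eqVneq y1 y2.
  rewrite -{}y12 in f1 f2 ny2 *.
  have [->//|/eqP x12] := eqVneq x1 x2.
  by case: (c4 x1 x2 y1 y) => //; auto.
have [x12|/eqP x12] := eqVneq x1 x2.
  rewrite -{}x12 in f1 f3 nx2 *.
  by case: (c4 x x1 y1 y2) => //; auto.
by case: (c6 x x1 x2 y1 y y2) => //; auto.
Qed.

(* Two paths of length 3 with the same endpoints would create a short cycle, so
   there are at most [M * N] of them. On an edge whose ends have degrees x, y >= 2,
   AM-GM gives 3 <= MN/T^2 xy + (T/M)/x + (T/N)/y and xy <= 4 (x - 1)(y - 1). *)
Lemma card_edges_le {R : realFieldType} (M N T : R) :
  0 < M -> 0 < N -> 0 < T -> (M * N) ^+ 2 <= T ^+ 3 ->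
  #|fst @: E|%:R <= M -> #|snd @: E|%:R <= N ->
  #|E|%:R <= #|fst @: E|%:R + #|snd @: E|%:R + 2 * T.
Proof.
move=> M0 N0 T0 MNT EM EN.
pose F := [set e in E | (1 < dX e.1)%N && (1 < dY e.2)%N].
have dXE e : e \in E -> (0 < dX e.1)%N.
  by move=> eE; apply/card_gt0P; exists e; rewrite !inE eE eqxx.
have dYE e : e \in E -> (0 < dY e.2)%N.
  by move=> eE; apply/card_gt0P; exists e; rewrite !inE eE eqxx.
(* An edge of E outside F has an end of degree 1, and this end determines it. *)
have cardE : (#|E| <= #|fst @: E| + #|snd @: E| + #|F|)%N.
  pose EX := [set e in E | (dX e.1 <= 1)%N]; pose EY := [set e in E | (dY e.2 <= 1)%N].
  have EXc : (#|EX| <= #|fst @: E|)%N.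
    rewrite -(card_in_imset (f := fst) (D := mem EX)).
      apply/subset_leq_card/imsetS/fintype.subsetP => e.
      by rewrite inE => /andP[].
    move=> e f; rewrite !inE => /andP[eE /card_le1_eqP h] /andP[fE _] ef.
    by apply: h; rewrite !inE ?eE ?fE /= ?ef eqxx.
  have EYc : (#|EY| <= #|snd @: E|)%N.
    rewrite -(card_in_imset (f := snd) (D := mem EY)).
      apply/subset_leq_card/imsetS/fintype.subsetP => e.
      by rewrite inE => /andP[].
    move=> e f; rewrite !inE => /andP[eE /card_le1_eqP h] /andP[fE _] ef.
    by apply: h; rewrite !inE ?eE ?fE /= ?ef eqxx.
  have sub : (#|E| <= #|EX :|: EY :|: F|)%N.
    apply/subset_leq_card/fintype.subsetP => e eE; rewrite !inE eE /=.
    by case: (leqP (dX _)) => //=; case: (leqP (dY _)).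
  apply: leq_trans sub _; apply: leq_trans (leq_card_setU _ _) _.
  by rewrite leq_add2r; apply: leq_trans (leq_card_setU _ _) (leq_add EXc EYc).
have sumX : \sum_(e in E) (dX e.1)%:R^-1 = #|fst @: E|%:R :> R.
  rewrite (partition_big fst (mem (fst @: E))) /=; last by move=> e; exact: imset_f.
  rewrite -sum1_card natr_sum; apply: eq_bigr => x /imsetP[e eE ->].
  rewrite (eq_bigr (fun=> (dX e.1)%:R^-1)); last by move=> f /andP[_ /eqP ->].
  rewrite sumr_const -[RHS](mulVf (x := (dX e.1)%:R)).
    rewrite -[LHS]mulr_natr; congr (_ * _%:R); apply: eq_card => f.
    by rewrite !inE.
  by rewrite pnatr_eq0 -lt0n dXE.
have sumY : \sum_(e in E) (dY e.2)%:R^-1 = #|snd @: E|%:R :> R.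
  rewrite (partition_big snd (mem (snd @: E))) /=; last by move=> e; exact: imset_f.
  rewrite -sum1_card natr_sum; apply: eq_bigr => x /imsetP[e eE ->].
  rewrite (eq_bigr (fun=> (dY e.2)%:R^-1)); last by move=> f /andP[_ /eqP ->].
  rewrite sumr_const -[RHS](mulVf (x := (dY e.2)%:R)).
    rewrite -[LHS]mulr_natr; congr (_ * _%:R); apply: eq_card => f.
    by rewrite !inE.
  by rewrite pnatr_eq0 -lt0n dYE.
have paths : \sum_(e in E) ((dX e.1).-1 * (dY e.2).-1)%:R <= M * N :> R.
  rewrite -natr_sum; apply: le_trans (_ : (#|fst @: E| * #|snd @: E|)%:R <= _).
    by rewrite ler_nat sum_path3_le.
  by rewrite natrM ler_pM.
pose G (e : X * Y) : R := 4 * (M * N / T ^+ 2) * ((dX e.1).-1 * (dY e.2).-1)%:R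
  + T / M * (dX e.1)%:R^-1 + T / N * (dY e.2)%:R^-1.
have G0 e : 0 <= G e.
  by rewrite /G !addr_ge0 // !mulr_ge0 ?invr_ge0 ?exprn_ge0 ?mulr_ge0 // ltW.
have GF e : e \in F -> 3 <= G e.
  rewrite inE => /andP[_ /andP[]]; rewrite /G.
  set x := dX _; set y := dY _ => x2 y2.
  have x0 : 0 < x%:R :> R by rewrite ltr0n; lia.
  have y0 : 0 < y%:R :> R by rewrite ltr0n; lia.
  apply: le_trans (amgm3 (T / M * x%:R^-1) (T / N * y%:R^-1) _ _) _.
  - by rewrite !mulr_gt0 ?invr_gt0.
  - by rewrite !mulr_gt0 ?invr_gt0.
  rewrite !lerD2r.
  have -> : (T / M / x%:R * (T / N / y%:R))^-1 = M * N / T ^+ 2 * (x * y)%:R.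
    rewrite natrM; field; by rewrite !gt_eqF.
  have c0 : 0 < M * N / T ^+ 2 by rewrite divr_gt0 ?exprn_gt0 ?mulr_gt0.
  have xy : (x * y)%:R <= 4 * (x.-1 * y.-1)%:R :> R by rewrite -natrM ler_nat; nia.
  by rewrite -[4 * _ * _]mulrA mulrCA ler_pM2l.
(* Summing G over E gives at most 4 (M N)^2 / T^2 + T + T <= 6 T. *)
have F3 : 3 * #|F|%:R <= 6 * T.
  rewrite -sum1_card natr_sum mulr_sumr.
  apply: le_trans (_ : \sum_(e in E) G e <= _).
    rewrite [leRHS](bigID [pred e | e \in F]) /=.
    rewrite -[leLHS]addr0 lerD ?sumr_ge0 //.
    rewrite [leRHS](eq_bigl (mem F)); last by move=> e; rewrite !inE; case: (e \in E).
    by apply: ler_sum => e eF; rewrite mulr1; exact: GF.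
  rewrite !big_split /= -!mulr_sumr sumX sumY.
  have h1 : T / M * #|fst @: E|%:R <= T.
    by rewrite -mulrA ger_pMr // mulrC ler_pdivrMr // mul1r.
  have h2 : T / N * #|snd @: E|%:R <= T.
    by rewrite -mulrA ger_pMr // mulrC ler_pdivrMr // mul1r.
  have c0 : 0 <= 4 * (M * N / T ^+ 2).
    by rewrite !mulr_ge0 ?invr_ge0 ?exprn_ge0 // ltW.
  have := ler_wpM2l c0 paths.
  have : 4 * (M * N / T ^+ 2) * (M * N) <= 4 * T.
    have -> : 4 * (M * N / T ^+ 2) * (M * N) = 4 * ((M * N) ^+ 2 / T ^+ 2) by ring.
    by rewrite ler_pM2l // ler_pdivrMr ?exprn_gt0 // -exprS.
  lra.
have : #|E|%:R <= #|fst @: E|%:R + #|snd @: E|%:R + #|F|%:R :> R.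
  by rewrite -!natrD ler_nat.
lra.
Qed.

End SparseGraph.

(** * Divisors, counting and product identities for the upper bound *)

(* The least divisor [u] of [m] with [n < u ^ 3] works: if [u ^ 3 > n ^ 2], then its
   least prime factor already satisfies [n < p ^ 3]. *)
Lemma dvd_large_or_prime {n m : nat} : (0 < m <= n)%N -> (n < m ^ 3)%N ->
  exists u, [/\ (u %| m)%N, (n < u ^ 3)%N & (u ^ 3 <= n ^ 2)%N || prime u].
Proof.
case/andP=> m0 mn nm.
have exu : exists u, (u %| m)%N && (n < u ^ 3)%N by exists m; rewrite dvdnn.
case: (ex_minnP exu) => u /andP[um nu] umin; exists u; split => //.
rewrite leqNgt; apply/orP; case: (boolP (n ^ 2 < u ^ 3)%N) => [n2u|]; [right|by left].
have u1 : (1 < u)%N.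
  by rewrite ltnNge; apply: contraL nu => u1; rewrite -leqNgt;
     apply: leq_trans (_ : 1 <= n)%N; [by rewrite -(exp1n 3) leq_exp2r | lia].
have p_pr := pdiv_prime u1; have pu := pdiv_dvd u.
set p := pdiv u in p_pr pu; have p1 := prime_gt1 p_pr.
suff -> : u = p by [].
apply/eqP; rewrite eqn_leq (dvdn_leq _ pu) ?andbT ?(ltnW u1) //.
apply: (umin p); rewrite (dvdn_trans pu um) /=.
(* By minimality of u its proper divisor u / p has cube at most n; then u^3 > n^2 forces p^3 > n,
   and minimality gives u <= p. *)
have q_small : ((u %/ p) ^ 3 <= n)%N.
  rewrite leqNgt; apply/negP => nq.
  have := umin (u %/ p)%N; rewrite nq andbT (dvdn_trans (dvdn_div pu) um).
  by move=> /(_ isT); rewrite leqNgt ltn_Pdiv // ltnW.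
have e : (u ^ 3 = p ^ 3 * (u %/ p) ^ 3)%N by rewrite -expnMn mulnC divnK.
rewrite e in n2u; have h := leq_mul (leqnn (p ^ 3)%N) q_small.
have : (n * n < p ^ 3 * n)%N by apply: leq_trans n2u _.
by rewrite ltn_mul2r => /andP[].
Qed.

Lemma card_pos_le {n k : nat} (S : {set 'I_n.+1}) :
  {in S, forall x : 'I_n.+1, (0 < x <= k)%N} -> (#|S| <= k)%N.
Proof.
move=> Sk; rewrite -(card_ord k).
pose f (x : 'I_n.+1) : 'I_k.+1 := inord x.
have finj : {in S &, injective f}.
  move=> x y /Sk/andP[_ xk] /Sk/andP[_ yk] /(congr1 val) /=.
  by rewrite !inordK // => /val_inj.
have -> : #|'I_k| = #|[set~ ord0 : 'I_k.+1]| by rewrite cardsC1 !card_ord.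
rewrite -(card_in_imset finj).
apply/subset_leq_card/fintype.subsetP => _ /imsetP[x /Sk/andP[x0 xk] ->].
by rewrite !inE -val_eqE /= inordK // -lt0n.
Qed.

Lemma card_pos_ler {R : realDomainType} {n : nat} {B : R} (S : {set 'I_n.+1}) : 0 <= B ->
  {in S, forall x : 'I_n.+1, (0 < x)%N /\ x%:R <= B} -> #|S|%:R <= B.
Proof.
move=> B0 SB; have [->|[x0 x0S]] := set_0Vmem S; first by rewrite cards0.
case: (@arg_maxnP _ x0 (mem S) (fun x => x : nat) x0S) => x xS xmax.
apply: le_trans (SB x xS).2; rewrite ler_nat.
by apply: card_pos_le => y yS; rewrite (SB y yS).1 /=; exact: xmax.
Qed.

Lemma card_fibers {T : finType} {K : nat} (S : {set T}) (g : T -> nat) :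
  {in S, forall x, (g x < K)%N} -> (\sum_(i < K) #|[set x in S | g x == i]|)%N = #|S|.
Proof.
move=> gK; rewrite -sum1_card.
rewrite (eq_bigr (fun i : 'I_K => \sum_(x in S | g x == i) 1)%N); last first.
  by move=> i _; rewrite -sum1_card; apply: eq_bigl => x; rewrite inE.
rewrite (exchange_big_dep (mem S)) /=; last by move=> i x _ /andP[].
apply: eq_bigr => x xS; rewrite sum1_card.
rewrite -(card1 (Ordinal (gK x xS))); apply: eq_card => i.
by rewrite [LHS]unfold_in xS [RHS]inE -val_eqE /= eq_sym.
Qed.

(* Padding [a1 a2 a3 = b1 b2 b3] to nine factors: a1 a2 a3 (b1 b2 b3)^2 is a cube. *)
Lemma product_triples {n : nat} {A : {set 'I_n.+1}} {a1 a2 a3 b1 b2 b3 : 'I_n.+1} :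
  only_trivial_solutions 9 3 A ->
  a1 \in A -> a2 \in A -> a3 \in A -> b1 \in A -> b2 \in A -> b3 \in A ->
  (a1 * a2 * a3 = b1 * b2 * b3)%N -> a1 \in [:: a2; a3; b1; b2; b3].
Proof.
move=> triv A1 A2 A3 B1 B2 B3 ab; apply: contraT => a1n.
pose t : 9.-tuple 'I_n.+1 := [tuple a1; a2; a3; b1; b1; b2; b2; b3; b3].
have tA i : tnth t i \in A.
  have : all (mem A) t by rewrite /= A1 A2 A3 B1 B2 B3.
  by move/all_tnthP; apply.
have tprod : \prod_(i < 9) (tnth t i : nat)%:Z = (b1 * b2 * b3)%N%:Z ^+ 3.
  rewrite !big_ord_recl big_ord0 !(tnth_nth ord0) /=.
  have := congr1 Posz ab; rewrite !PoszM => ab'.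
  transitivity ((a1 : nat)%:Z * (a2 : nat)%:Z * (a3 : nat)%:Z * ((b1 : nat)%:Z * (b2 : nat)%:Z * (b3 : nat)%:Z) ^+ 2); first by ring.
  by rewrite ab'; ring.
(* Here [a1] occurs exactly once in [t], and 3 does not divide 1. *)
have /(trivial_solutionE (isT : (0 < 3)%N))/(_ a1) := triv t _ tA tprod.
move: a1n; rewrite !inE !negb_or /= => /and5P[h1 h2 h3 h4 h5].
by rewrite eqxx ![_ == a1]eq_sym (negbTE h1) (negbTE h2) (negbTE h3) (negbTE h4) (negbTE h5).
Qed.

(** [prime_count] is defined with a classical set, while the counting is done with finite sets. *)
Lemma prime_countE (n : nat) : prime_count n = #|[set p : 'I_n.+1 | prime p]%SET|.
Proof.
by apply: eq_card => p; rewrite inE; apply/idP/idP; rewrite in_setE.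
Qed.

Lemma powR23_cube {R : realType} (n : nat) : ((n%:R : R) `^ (2 / 3)) ^+ 3 = n%:R ^+ 2.
Proof.
by rewrite -powR_mulrn ?powR_ge0 // -powRrM -powR_mulrn ?ler0n //; congr (_ `^ _); field.
Qed.

Lemma cube_le_sqr {R : realType} {n x : nat} :
  (x ^ 3 <= n ^ 2)%N -> x%:R <= (n%:R : R) `^ (2 / 3).
Proof.
move=> xn; rewrite -(ler_pXn2r (n := 3)) ?nnegrE ?powR_ge0 ?ler0n //.
by rewrite powR23_cube -!natrX ler_nat.
Qed.

(** * The upper bound *)

Section UpperBound.
Context {R : realType} {n : nat} {A : {set 'I_n.+1}}.
Hypothesis A_pos : forall i, i \in A -> (0 < i)%N.
Hypothesis A_triv : only_trivial_solutions 9 3 A.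
Hypothesis n_gt0 : (0 < n)%N.

Variable f : nat -> nat.
Hypothesis fP : forall m, (0 < m <= n)%N -> (n < m ^ 3)%N ->
  [/\ (f m %| m)%N, (n < f m ^ 3)%N & (f m ^ 3 <= n ^ 2)%N || prime (f m)].

Let B := [set m in A | (n < m ^ 3)%N].
Let edge (m : 'I_n.+1) : 'I_n.+1 * 'I_n.+1 := (inord (f m), inord (m %/ f m)).
Let E := edge @: B.
Let T : R := n%:R `^ (2 / 3).

Let T_gt0 : 0 < T. Proof. by rewrite powR_gt0 // ltr0n. Qed.

Let edgeP m : m \in B ->
  [/\ (edge m).1 = f m :> nat, (edge m).2 = (m %/ f m)%N :> nat,
      (n < (edge m).1 ^ 3)%N, ((edge m).1 ^ 3 <= n ^ 2)%N || prime (edge m).1 &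
      ((edge m).1 * (edge m).2)%N = m].
Proof.
rewrite inE => /andP[/A_pos m0 nm].
have mn : (m <= n)%N by rewrite -ltnS.
have m0n : (0 < m <= n)%N by rewrite m0.
have [fm nf pf] := fP m m0n nm.
have f_le : (f m <= n)%N by apply: leq_trans mn; apply: dvdn_leq.
have d_le : (m %/ f m <= n)%N by apply: leq_trans mn; apply: leq_div.
rewrite /edge /= !inordK ?ltnS //; split => //.
by rewrite mulnC divnK.
Qed.

Let E_inv {x y} : (x, y) \in E -> exists m, [/\ m \in A, edge m = (x, y),
  (x * y)%N = m, (n < x ^ 3)%N & (x ^ 3 <= n ^ 2)%N || prime x].
Proof.
case/imsetP=> m mB /= xy; exists m; have := edgeP m mB.
by rewrite -xy => -[_ _ h1 h2 h3]; split=> //; move: mB; rewrite inE => /andP[].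
Qed.

(** The two pairs of opposite edges of a 4-cycle have equal products; the extra factor [m22] brings
    both sides to three factors. *)
Let E_c4 : c4_free (fun x y => (x, y) \in E).
Proof.
move=> x1 x2 y1 y2 /E_inv[m11 [A11 e11 p11 _ _]] /E_inv[m12 [A12 e12 p12 _ _]].
move=> /E_inv[m21 [A21 e21 p21 _ _]] /E_inv[m22 [A22 e22 p22 _ _]] x12 y12.
have pr : (m11 * m22 * m22 = m12 * m21 * m22)%N by rewrite -p11 -p22 -p12 -p21; lia.
have := product_triples A_triv A11 A22 A22 A12 A21 A22 pr.
by rewrite !inE => /or4P[| | |/orP[]] /eqP h; move: e11; rewrite h ?e22 ?e12 ?e21 => -[]; auto.
Qed.

Let E_c6 : c6_free (fun x y => (x, y) \in E).
Proof.
move=> x1 x2 x3 y1 y2 y3 /E_inv[m11 [A11 e11 p11 _ _]] /E_inv[m21 [A21 e21 p21 _ _]].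
move=> /E_inv[m22 [A22 e22 p22 _ _]] /E_inv[m32 [A32 e32 p32 _ _]].
move=> /E_inv[m33 [A33 e33 p33 _ _]] /E_inv[m13 [A13 e13 p13 _ _]] x12 x23 x31 y12 y23 y31.
have pr : (m11 * m22 * m33 = m21 * m32 * m13)%N.
  by rewrite -p11 -p22 -p33 -p21 -p32 -p13; lia.
have := product_triples A_triv A11 A22 A33 A21 A32 A13 pr.
by rewrite !inE => /or4P[| | |/orP[]] /eqP h; move: e11;
  rewrite h ?e22 ?e33 ?e21 ?e32 ?e13 => -[]; auto.
Qed.

Let cardB : #|B| = #|E|.
Proof.
rewrite card_in_imset // => m1 m2 /edgeP[_ _ _ _ e1] /edgeP[_ _ _ _ e2] e12.
by apply: val_inj; rewrite /= -e1 -e2 e12.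
Qed.

Let card_fst : #|fst @: E|%:R <= (prime_count n)%:R + T.
Proof.
pose S := [set x : 'I_n.+1 | (0 < x)%N && (x ^ 3 <= n ^ 2)%N]%SET.
pose P := [set p : 'I_n.+1 | prime p]%SET.
have sub : (#|fst @: E| <= #|P :|: S|)%N.
  apply/subset_leq_card/fintype.subsetP => x /imsetP[[x' y] /E_inv[m [_ _ _ h1 h2]] /= ->].
  rewrite !inE; case: (boolP (prime x')) h2 => //=; rewrite orbF => _ ->.
  by rewrite andbT; have [x0|] := posnP x'; [rewrite x0 exp0n in h1|].
have cS : #|S|%:R <= T.
  apply: card_pos_ler => [|x]; first exact: ltW T_gt0.
  by rewrite inE => /andP[x0 x3]; split; rewrite // cube_le_sqr.
apply: le_trans (_ : (#|P| + #|S|)%:R <= _).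
  by rewrite ler_nat; apply: leq_trans sub (leq_card_setU _ _).
by rewrite natrD prime_countE lerD2l.
Qed.

(** Since x^3 > n and x y <= n, y^3 > n^2 is impossible. *)
Let card_snd : #|snd @: E|%:R <= T.
Proof.
apply: card_pos_ler => [|y /imsetP[[x y'] /E_inv[m [mA _ p h1 _]] /= ->]]; first exact: ltW T_gt0.
have m0 := A_pos m mA; split; first by move: m0; rewrite -p muln_gt0 => /andP[].
apply: cube_le_sqr.
have mn : (x * y' <= n)%N by rewrite p -ltnS.
have mn3 : (x ^ 3 * y' ^ 3 <= n * n ^ 2)%N by rewrite -expnMn -expnS leq_exp2r.
rewrite leqNgt; apply/negP => h.
by have := ltn_mul h1 h; rewrite ltnNge mn3.
Qed.

Let Ei (i : nat) := [set e in E | trunc_log 2 e.1 == i]%SET.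

Let card_Ei (i : nat) :
  #|Ei i|%:R <= #|[set x in fst @: E | trunc_log 2 x == i]%SET|%:R + T + 4 * T.
Proof.
have sub e : e \in Ei i -> e \in E by rewrite inE => /andP[].
have EiP x y : (x, y) \in Ei i -> [/\ (0 < x)%N, (2 ^ i <= x)%N, (x < 2 ^ i.+1)%N,
    (0 < y)%N & (x * y <= n)%N].
  rewrite inE /= => /andP[/E_inv[m [mA _ p h1 _]] /eqP hi].
  have := A_pos m mA; rewrite -p muln_gt0 => /andP[x0 y0].
  have := trunc_log_ltn x (isT : (1 < 2)%N); have := trunc_logP (isT : (1 < 2)%N) x0.
  by rewrite hi => lo hi'; split => //; rewrite p -ltnS.
have p2 k : 0 < 2 ^+ k :> R by rewrite exprn_gt0.
(* In this range x < 2^(i+1) and y <= n / 2^i, so M N = 2 n, and (M N)^2 = 4 n^2 is at most (2 T)^3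
   = 8 n^2. *)
have := @card_edges_le _ _ (Ei i) _ _ R (2 ^+ i.+1) (n%:R / 2 ^+ i) (2 * T).
set H := (X in X -> _ -> _) => H0.
have {H0} : #|Ei i|%:R <= #|fst @: Ei i|%:R + #|snd @: Ei i|%:R + 2 * (2 * T).
  apply: H0.
  - by move=> x1 x2 y1 y2 /sub h1 /sub h2 /sub h3 /sub h4; exact: E_c4.
  - move=> x1 x2 x3 y1 y2 y3 /sub h1 /sub h2 /sub h3 /sub h4 /sub h5 /sub h6; exact: E_c6.
  - exact: p2.
  - by rewrite divr_gt0 ?ltr0n.
  - by rewrite mulr_gt0.
  - have -> : (2 * T) ^+ 3 = 8 * n%:R ^+ 2 by rewrite -powR23_cube /T; ring.
    have -> : 2 ^+ i.+1 * (n%:R / 2 ^+ i) = 2 * n%:R :> R.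
      by rewrite exprS; field; rewrite gt_eqF.
    have : 0 <= n%:R ^+ 2 :> R by rewrite exprn_ge0.
    lra.
  - apply: card_pos_ler => [|x /imsetP[[x' y] /EiP[h1 h2 h3 h4 h5] /= ->]]; first exact: ltW (p2 _).
    by split; rewrite // -natrX ler_nat ltnW.
  - apply: card_pos_ler => [|y /imsetP[[x y'] /EiP[h1 h2 h3 h4 h5] /= ->]].
      by rewrite divr_ge0 // ltW.
    split; rewrite // ler_pdivlMr // -natrX -natrM ler_nat mulnC.
    by apply: leq_trans h5; rewrite leq_mul2r h2 orbT.
have : #|fst @: Ei i|%:R <= #|[set x in fst @: E | trunc_log 2 x == i]%SET|%:R :> R.
  rewrite ler_nat; apply/subset_leq_card/fintype.subsetP => x /imsetP[e eEi ->].
  rewrite inE; move: eEi; rewrite inE => /andP[eE ei].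
  by rewrite ei andbT imset_f.
have : #|snd @: Ei i|%:R <= T.
  apply: le_trans card_snd; rewrite ler_nat.
  by apply/subset_leq_card/imsetS/fintype.subsetP.
lra.
Qed.

(** One T bounds the first vertices with x^3 <= n^2, another the elements with m^3 <= n, which are
    not in [B]; each dyadic range adds 5 T. *)
Lemma admissible_card_le_split :
  #|A|%:R <= (prime_count n)%:R + (2 + 5 * (trunc_log 2 n).+1%:R) * T.
Proof.
have [K KE] : exists K, K = (trunc_log 2 n).+1 by eexists.
rewrite -KE.
have logK (x : 'I_n.+1) : (trunc_log 2 x < K)%N.
  by rewrite KE ltnS; apply: leq_trunc_log; rewrite -ltnS.
have cE : #|E|%:R <= #|fst @: E|%:R + K%:R * (5 * T).
  rewrite -(card_fibers (K := K) E (fun e => trunc_log 2 e.1)) => [|e _]; last exact: logK.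
  rewrite natr_sum.
  apply: le_trans (ler_sum _ (fun (i : 'I_K) _ => card_Ei i)) _.
  rewrite !big_split /= !sumr_const card_ord -natr_sum.
  rewrite (card_fibers (K := K) (fst @: E) (fun x : 'I_n.+1 => trunc_log 2 x)) => [|x _]; last exact: logK.
  by rewrite -[T *+ K]mulr_natl -[_ * T *+ K]mulr_natl -addrA lerD2l -mulrDr ler_wpM2l //; lra.
have cA : (#|A| <= #|A :\: B| + #|E|)%N by rewrite -cardB -(cardsID B A) addnC leq_add2l subset_leq_card // subsetIr.
have cD : #|A :\: B|%:R <= T.
  apply: card_pos_ler => [|x]; first exact: ltW T_gt0.
  rewrite !inE => /andP[h xA]; split; first exact: A_pos.
  apply: cube_le_sqr; move: h; rewrite xA /= -leqNgt => h.
  by apply: leq_trans h _; rewrite -{1}(expn1 n) leq_pexp2l.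
move: cA; rewrite -(ler_nat R) natrD => cA.
have := card_fst; lra.
Qed.

End UpperBound.

Lemma max_size_le {R : realType} {n : nat} : (0 < n)%N ->
  (max_size 9 3 n)%:R <=
    (prime_count n)%:R + (2 + 5 * (trunc_log 2 n).+1%:R) * n%:R `^ (2 / 3) :> R.
Proof.
move=> n0.
pose P (m u : nat) := (0 < m <= n)%N -> (n < m ^ 3)%N ->
  [/\ (u %| m)%N, (n < u ^ 3)%N & (u ^ 3 <= n ^ 2)%N || prime u].
have /boolp.choice[f fP] m : exists u, P m u.
  rewrite /P.
  have [m0|] := boolP (0 < m <= n)%N; last by exists 0%N.
  have [nm|] := boolP (n < m ^ 3)%N; last by exists 0%N.
  by have [u hu] := dvd_large_or_prime m0 nm; exists u.
(* The maximum is attained once some set is admissible; the empty set is, as no nine factors can be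
   taken from it. *)
have := @eq_bigmax_cond {set 'I_n.+1} (fun A : {set 'I_n.+1} => `[< admissible 9 3 A >]) (fun A => #|A|).
case.
  apply/card_gt0P; exists (finset.set0 : {set _}); apply/asboolP; split=> [i|a x aA _]; first by rewrite inE.
  by have := aA ord0; rewrite inE.
by move=> A /asboolP[A0 A1]; rewrite /max_size => ->; exact: (admissible_card_le_split A0 A1 n0 f fP).
Qed.

(** * Chebyshev's lower bound *)

(** By Legendre's formula each j contributes at most 1 to the exponent, and only when p^j <= 2 m. *)
Lemma logn_bin_le {m p : nat} : (0 < m)%N -> prime p -> (p ^ logn p 'C(m.*2, m) <= m.*2)%N.
Proof.
move=> m0 p_pr.
have m20 : (0 < m.*2)%N by rewrite double_gt0.
have bin_f : ('C(m.*2, m) * (m`! * m`!) = (m.*2)`!)%N.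
  by have := bin_fact (leq_addl m m); rewrite addnK addnn.
set k := trunc_log p m.*2.
have logs : (logn p (m.*2)`! <= k + (logn p m`!).*2)%N.
  rewrite !logn_fact //.
  have ext : (\sum_(1 <= j < m.+1) m %/ p ^ j = \sum_(1 <= j < (m.*2).+1) m %/ p ^ j)%N.
    rewrite [RHS](big_cat_nat (n := m.+1)) //=; last by rewrite ltnS -addnn leq_addr.
    rewrite [X in (_ + X)%N]big1_seq ?addn0 // => j /andP[_]; rewrite mem_index_iota => /andP[mj _].
    by rewrite divn_small // (leq_trans mj) // ltnW // ltn_expl // prime_gt1.
  rewrite ext -[X in (_ <= _ + X)%N]addnn -big_split /=.
  have kE : k = (\sum_(1 <= j < (m.*2).+1) (j <= k))%N.
    have kle : (k <= m.*2)%N.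
      by apply: ltnW; apply: leq_trans (ltn_expl k (prime_gt1 p_pr)) _; exact: trunc_logP (prime_gt1 p_pr) m20.
    rewrite (big_cat_nat (n := k.+1)) //=.
    rewrite [X in (_ + X)%N]big1_seq ?addn0; last first.
      by move=> j /andP[_]; rewrite mem_index_iota => /andP[]; rewrite ltnNge => /negbTE ->.
    rewrite (eq_big_nat _ _ (F2 := fun=> 1%N)); last by move=> j /andP[_]; rewrite ltnS => ->.
    by rewrite sum_nat_const_nat subSS subn0 muln1.
  rewrite {1}kE -big_split /=; apply: leq_sum => j _.
  have pj : (0 < p ^ j)%N by rewrite expn_gt0 prime_gt0.
  case: (leqP j k) => jk /=.
    have := ltn_ceil m pj; set c := (m %/ p ^ j)%N => mc.
    by rewrite -ltnS ltn_divLR // -addnn; nia.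
  rewrite divn_small //; apply: leq_trans (trunc_log_ltn _ (prime_gt1 p_pr)) _.
  by rewrite leq_pexp2l // prime_gt0.
have := congr1 (logn p) bin_f.
rewrite !lognM ?muln_gt0 ?fact_gt0 ?bin_gt0 -?addnn ?leq_addr // !addnn => e.
have lek : (logn p 'C(m.*2, m) <= k)%N by rewrite -e -!addnn in logs *; lia.
apply: leq_trans (leq_pexp2l (prime_gt0 p_pr) lek) _.
exact: trunc_logP (prime_gt1 p_pr) m20.
Qed.

(** From m to m + 1 the coefficient is multiplied by 2 (2 m + 1) / (m + 1) >= 2. *)
Lemma expn2_le_bin (m : nat) : (2 ^ m <= 'C(m.*2, m))%N.
Proof.
elim: m => // m IHm.
have e : (m.+1 * 'C(m.+1.*2, m.+1) = (m.*2.+1).*2 * 'C(m.*2, m))%N.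
  have h1 : (m.+1 * 'C(m.*2.+2, m.+1) = m.*2.+2 * 'C(m.*2.+1, m))%N by rewrite mul_bin_diag.
  have h2 := mul_bin_left m.*2.+1 m; have h3 := mul_bin_diag m.*2.+1 m.
  have h4 : ('C(m.*2.+1, m) = 'C(m.*2.+1, m.+1))%N.
    rewrite -bin_sub; last by rewrite -addnn; lia.
    by congr binomial; rewrite -addnn; lia.
  have h5 : (m.+1 * 'C(m.*2.+1, m.+1) = m.*2.+1 * 'C(m.*2, m))%N by rewrite mul_bin_diag.
  by rewrite doubleS h1 h4 -!addnn in h5 *; nia.
rewrite -(leq_pmul2l (ltn0Sn m)) e expnS mulnCA mulnA leq_mul //.
by rewrite -!addnn; lia.
Qed.

Definition small_primes (n : nat) : {set 'I_n.+1} :=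
  [set p : 'I_n.+1 | prime p && (p ^ 2 <= n)%N]%SET.

(** The prime powers exactly dividing C(2m, m) are at most 2 m, and its primes are at most 2 m <=
    sqrt n, so it is at most 2 m to the power pi(sqrt n). *)
Lemma expn2_le_small_primes {m n : nat} : (0 < m)%N -> (m.*2 ^ 2 <= n)%N ->
  (2 ^ m <= m.*2 ^ #|small_primes n|)%N.
Proof.
move=> m0 mn; apply: leq_trans (expn2_le_bin m) _.
have C0 : (0 < 'C(m.*2, m))%N by rewrite bin_gt0 -addnn leq_addr.
have Cs p : p \in primes 'C(m.*2, m) -> (p ^ 2 <= n)%N.
  rewrite mem_primes => /and3P[p_pr _ pC]; apply: leq_trans mn; rewrite leq_exp2r //.
  apply: leq_trans (logn_bin_le m0 p_pr); rewrite -{1}(expn1 p) leq_pexp2l ?(prime_gt0 p_pr) //.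
  by rewrite logn_gt0 mem_primes p_pr C0.
rewrite {1}(prod_prime_decomp C0) prime_decompE big_map /=.
apply: (@leq_trans (\prod_(p <- primes 'C(m.*2, m)) m.*2)%N).
  rewrite big_seq [leqRHS]big_seq; apply: leq_prod => p; rewrite mem_primes => /andP[p_pr _].
  exact: logn_bin_le m0 p_pr.
rewrite big_const_seq iter_muln_1 count_predT leq_pexp2l ?double_gt0 //.
pose l : seq 'I_n.+1 := [seq inord p | p <- primes 'C(m.*2, m)].
have lval : map val l = primes 'C(m.*2, m).
  rewrite -map_comp -[RHS]map_id; apply/eq_in_map => p pC /=.
  rewrite inordK // ltnS; apply: leq_trans (Cs p pC).
  by rewrite -{1}(expn1 p) leq_pexp2l //; move: pC; rewrite mem_primes => /andP[/prime_gt0].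
have l_uniq : uniq l by rewrite -(map_inj_uniq val_inj) lval primes_uniq.
rewrite -lval size_map -(card_uniqP l_uniq).
apply/subset_leq_card/fintype.subsetP => p pl; rewrite inE.
have pC : val p \in primes 'C(m.*2, m) by rewrite -lval map_f.
by rewrite Cs // andbT; move: pC; rewrite mem_primes => /andP[].
Qed.

(** * The lower bound *)

Section Incidence.
Context {F : finFieldType}.

(* Points [(a, b, c)] and lines [(k, s, t)] of the bipartite graph D(3, q) of
   Lazebnik and Ustimenko, which has girth 8. *)
Definition incident (p l : F * F * F) : bool :=
  let: (a, b, c) := p in let: (k, s, t) := l in
  (b + s == a * k) && (c + t == a * s).

(** The equations give (a1 - a2)(k1 - k2) = 0, and a vertex together with the first coordinate of a
    neighbour determines that neighbour. *)
Lemma incident_c4_free : c4_free incident.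
Proof.
move=> [[a1 b1] c1] [[a2 b2] c2] [[k1 s1] t1] [[k2 s2] t2] /=.
move=> /andP[/eqP h1 /eqP g1] /andP[/eqP h2 /eqP g2].
move=> /andP[/eqP h3 /eqP g3] /andP[/eqP h4 /eqP g4] np nl.
have : (a1 - a2) * (k1 - k2) == 0.
  by apply/eqP; rewrite mulrBl !mulrBr -h1 -h2 -h3 -h4; ring.
rewrite mulf_eq0 !subr_eq0 => /orP[] /eqP e; subst.
  apply: np; have b12 : b1 = b2 by apply: (addIr s1); rewrite h1 h3.
  by have c12 : c1 = c2; [apply: (addIr t1); rewrite g1 g3 | rewrite b12 c12].
apply: nl; have s12 : s1 = s2 by apply: (addrI b1); rewrite h1 h2.
subst; by have t12 : t1 = t2; [apply: (addrI c1); rewrite g1 g2 | rewrite t12].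
Qed.

(* Subtracting [a1] times the first-coordinate identity around the hexagon from
   the second-coordinate one leaves (a2 - a3) (k2 - k3) (a3 - a1) = 0. *)
Lemma incident_c6_free : c6_free incident.
Proof.
move=> [[a1 b1] c1] [[a2 b2] c2] [[a3 b3] c3] [[k1 s1] t1] [[k2 s2] t2] [[k3 s3] t3] /=.
move=> /andP[/eqP h1 /eqP g1] /andP[/eqP h2 /eqP g2].
move=> /andP[/eqP h3 /eqP g3] /andP[/eqP h4 /eqP g4].
move=> /andP[/eqP h5 /eqP g5] /andP[/eqP h6 /eqP g6] p12 p23 p31 l12 l23 l31.
have e1 : (a1 - a2) * (k1 - k3) + (a2 - a3) * (k2 - k3) = 0.
  transitivity (a1 * k1 - a2 * k1 + (a2 * k2 - a3 * k2) + (a3 * k3 - a1 * k3)); first by ring.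
  by rewrite -h1 -h2 -h3 -h4 -h5 -h6; ring.
have e2 : (a1 - a2) * (s1 - s3) + (a2 - a3) * (s2 - s3) = 0.
  transitivity (a1 * s1 - a2 * s1 + (a2 * s2 - a3 * s2) + (a3 * s3 - a1 * s3)); first by ring.
  by rewrite -g1 -g2 -g3 -g4 -g5 -g6; ring.
have e3 : s1 - s3 = a1 * (k1 - k3) by rewrite mulrBr -h1 -h6; ring.
have e4 : s2 - s3 = a3 * (k2 - k3) by rewrite mulrBr -h4 -h5; ring.
have : (a2 - a3) * (k2 - k3) * (a3 - a1) == 0.
  apply/eqP; rewrite e3 e4 in e2.
  transitivity (((a1 - a2) * (a1 * (k1 - k3)) + (a2 - a3) * (a3 * (k2 - k3))) -
    a1 * ((a1 - a2) * (k1 - k3) + (a2 - a3) * (k2 - k3))); first by ring.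
  by rewrite e1 e2 mulr0 subr0.
(* A vanishing factor makes two neighbours of a common vertex agree in the first coordinate, hence
   coincide. *)
rewrite !mulf_eq0 !subr_eq0 -orbA => /or3P[] /eqP e; subst.
- apply: p23; have b12 : b2 = b3 by apply: (addIr s2); rewrite h3 h4.
  by have c12 : c2 = c3; [apply: (addIr t2); rewrite g3 g4 | rewrite b12 c12].
- apply: l23; have s12 : s2 = s3 by apply: (addrI b3); rewrite h4 h5.
  subst; by have t12 : t2 = t3; [apply: (addrI c3); rewrite g4 g5 | rewrite t12].
- apply: p31; have b12 : b3 = b1 by apply: (addIr s3); rewrite h5 h6.
  by have c12 : c3 = c1; [apply: (addIr t3); rewrite g5 g6 | rewrite b12 c12].
Qed.

Lemma card_incident : #|[set e | incident e.1 e.2]%SET| = (#|F| ^ 4)%N.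
Proof.
pose h (z : F * F * F * F) : (F * F * F) * (F * F * F) :=
  let: (a, b, c, k) := z in
  ((a, b, c), (k, a * k - b, a * (a * k - b) - c)).
have -> : [set e | incident e.1 e.2]%SET = h @: [set: _]%SET.
  apply/setP => -[[[a b] c] [[k s] t]]; rewrite inE /=; apply/idP/imsetP.
    case/andP=> /eqP h1 /eqP h2; exists (a, b, c, k); rewrite ?inE // /h.
    by rewrite -h1 [b + s]addrC addrK -h2 [c + t]addrC addrK.
  by case=> -[[[a' b'] c'] k'] _ /= [-> -> -> -> -> ->]; rewrite !subrKC !eqxx.
rewrite card_imset; first by rewrite cardsT !card_prod !expnS expn0 muln1 !mulnA.
by move=> [[[a b] c] k] [[[a' b'] c'] k'] /= [-> -> -> ->].
Qed.

End Incidence.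

(** * From a graph to an admissible set *)

Lemma injection_into {T U : finType} (S : {set U}) : (#|T| <= #|S|)%N ->
  exists2 g : T -> U, injective g & forall x, g x \in S.
Proof.
move=> TS; exists (fun x => enum_val (widen_ord TS (enum_rank x))) => [x y|x].
  by move/enum_val_inj/(congr1 val) => xy; apply/enum_rank_inj/val_inj.
exact: enum_valP.
Qed.

Lemma logn_prod {I : eqType} (p : nat) (r : seq I) (h : I -> nat) :
  {in r, forall i, (0 < h i)%N} ->
  logn p (\prod_(i <- r) h i) = (\sum_(i <- r) logn p (h i))%N.
Proof.
elim: r => [|i r IHr] h0; first by rewrite !big_nil logn1.
have h0' : {in r, forall j, (0 < h j)%N} by move=> j jr; rewrite h0 // inE jr orbT.
rewrite !big_cons lognM ?h0 ?mem_head ?IHr //.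
by rewrite big_seq; apply: prodn_cond_gt0.
Qed.

Lemma count_mem_sum {T : eqType} (b : T) (s : seq T) :
  count_mem b s = (\sum_(c <- s) (c == b))%N.
Proof. by rewrite -sum1_count big_mkcond; apply: eq_bigr => c _ /=; case: eqP. Qed.

Section LowerBound.
Context {n : nat} {X Y : finType} (inc : X -> Y -> bool).
Hypothesis inc_c4 : c4_free inc.
Hypothesis inc_c6 : c6_free inc.

Variable g : X + Y -> 'I_n.+1.
Hypothesis g_inj : injective g.
Hypothesis g_small : forall z, g z \in small_primes n.

Local Notation px x := (g (inl x)).
Local Notation ly y := (g (inr y)).
Let phi (e : X * Y) : 'I_n.+1 := inord (px e.1 * ly e.2).
Let L := [set p : 'I_n.+1 | prime p && (n < p ^ 2)%N]%SET.
Let C := phi @: [set e | inc e.1 e.2]%SET.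

Let g_prime z : prime (g z).
Proof. by have := g_small z; rewrite inE => /andP[]. Qed.

Let g_le z : (g z ^ 2 <= n)%N.
Proof. by have := g_small z; rewrite inE => /andP[]. Qed.

Let phiE e : phi e = (px e.1 * ly e.2)%N :> nat.
Proof.
rewrite /phi inordK //.
rewrite ltnS -(@leq_exp2r _ _ 2) // expnMn.
by rewrite -[(n ^ 2)%N]mulnn; apply: leq_mul (g_le _) (g_le _).
Qed.

(** Only the labels of its two ends divide an edge product, so the exponent of [g z] in a product of
    edges is the weighted degree of z. *)
Let logn_phi z e : logn (g z) (phi e) = ((z == inl e.1) + (z == inr e.2))%N.
Proof.
rewrite phiE lognM ?prime_gt0 // !logn_prime //.
by rewrite !(inj_eq val_inj) !(inj_eq g_inj).
Qed.

Let phi_inj : injective phi.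
Proof.
move=> [x y] [x' y'] e.
have := logn_phi (inl x) (x', y'); rewrite -e logn_phi /=.
have := logn_phi (inr y) (x', y'); rewrite -e logn_phi /=.
rewrite !eqxx /= addn0 add0n.
rewrite (inj_eq inr_inj) (inj_eq inl_inj) addn0.
by case: eqP => [->|] // _; case: eqP => [->|].
Qed.

Let small_large z (p : 'I_n.+1) : p \in L -> g z != p.
Proof.
rewrite inE => /andP[_ np]; apply: contraTneq np => <-.
by rewrite -leqNgt.
Qed.

Let phi_notin_L e : phi e \notin L.
Proof.
apply/negP => eL; have := small_large (inl e.1) _ eL; move: eL.
rewrite inE => /andP[e_pr _]; have := logn_phi (inl e.1) e.
rewrite logn_prime // eqxx (inj_eq val_inj) /= addn0 => e1 /negbTE ne.
by rewrite ne in e1.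
Qed.

Let A := L :|: C.

Let A_cases c : c \in A ->
  c \in L \/ exists2 e : X * Y, inc e.1 e.2 & c = phi e.
Proof.
rewrite inE => /orP[|/imsetP[e]]; [by left|rewrite inE => ? ->].
by right; exists e.
Qed.

(** Marks the edge whose product is c, if there is one; summed over the factors of a solution it
    gives the edge weights. *)
Let delta (c : 'I_n.+1) x y : nat := inc x y && (c == phi (x, y)).

Let delta_L c x y : c \in L -> delta c x y = 0%N.
Proof.
move=> cL; rewrite /delta; case: eqP => [e|]; last by rewrite andbF.
by have := phi_notin_L (x, y); rewrite -e cL.
Qed.

Let delta_C e x y : inc e.1 e.2 -> delta (phi e) x y = ((x == e.1) && (y == e.2)).
Proof.
move=> ie; rewrite /delta (inj_eq phi_inj) [_ == (x, y)]eq_sym.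
case: e ie => x' y' /= ie; rewrite xpair_eqE.
by case: eqP => [->|]; case: eqP => [->|]; rewrite ?ie ?andbF.
Qed.

Let sum_delta_row c x : c \in A -> (\sum_y delta c x y)%N = logn (px x) c.
Proof.
case/A_cases => [cL|[e ie ->]].
  rewrite big1 => [|y _]; last exact: delta_L.
  move: (cL); rewrite inE => /andP[c_pr _]; rewrite logn_prime //.
  by have := small_large (inl x) _ cL; rewrite -(inj_eq val_inj) => /negbTE ->.
rewrite logn_phi addn0 (inj_eq inl_inj).
under eq_bigr do rewrite delta_C //.
rewrite (bigD1 e.2) //= eqxx andbT big1 ?addn0 // => y /negbTE ->.
by rewrite andbF.
Qed.

Let sum_delta_col c y : c \in A -> (\sum_x delta c x y)%N = logn (ly y) c.
Proof.
case/A_cases => [cL|[e ie ->]].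
  rewrite big1 => [|x _]; last exact: delta_L.
  move: (cL); rewrite inE => /andP[c_pr _]; rewrite logn_prime //.
  by have := small_large (inr y) _ cL; rewrite -(inj_eq val_inj) => /negbTE ->.
rewrite logn_phi add0n (inj_eq inr_inj).
under eq_bigr do rewrite delta_C //.
by rewrite (bigD1 e.1) //= eqxx big1 ?addn0 // => x /negbTE ->.
Qed.

(** Each factor marks at most one edge, so nine factors have total weight at most 9, below the
    threshold 12 of [weights_dvd3]. *)
Let sum_delta c : c \in A -> (\sum_y \sum_x delta c x y <= 1)%N.
Proof.
move=> cA; under eq_bigr do rewrite sum_delta_col //.
case/A_cases: cA => [cL|[e ie ->]].
  rewrite big1 // => y _.
  move: (cL); rewrite inE => /andP[c_pr _]; rewrite logn_prime //.
  by have := small_large (inr y) _ cL; rewrite -(inj_eq val_inj) => /negbTE ->.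
under eq_bigr do rewrite logn_phi add0n (inj_eq inr_inj).
by rewrite (bigD1 e.2) //= eqxx big1 // => y /negbTE ->.
Qed.

Let A_pos c : c \in A -> (0 < c)%N.
Proof.
case/A_cases => [|[e _ ->]]; first by rewrite inE => /andP[/prime_gt0].
by rewrite phiE muln_gt0 !prime_gt0.
Qed.

(** All prime exponents of a cube are multiples of 3. At a large prime the exponent is its
    multiplicity, since it divides no other element of A; at the labels the exponents are the
    weighted degrees, and [weights_dvd3] applies. *)
Lemma incidence_set_admissible : admissible 9 3 A.
Proof.
split; first exact: A_pos.
move=> a x aA a_prod.
have {}aA c : c \in (a : seq _) -> c \in A by move/tnthP => [i ->].
have dvd_logn p : (3 %| \sum_(c <- a) logn p c)%N.
  rewrite -(logn_prod p a (fun c : 'I_n.+1 => c : nat)); last by move=> c /aA/A_pos.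
  have -> : (\prod_(c <- a) c)%N = (`|x| ^ 3)%N.
    rewrite -abszX -a_prod big_tuple.
    by rewrite -(big_morph Posz PoszM (erefl _)).
  by rewrite lognX dvdn_mulr.
apply/trivial_solutionE => // b.
have [/aA/A_cases bA|/count_memPn ->] := boolP (b \in (a : seq _)); last exact: dvdn0.
case: bA => [bL|[e ie ->]].
  have -> : count_mem b a = (\sum_(c <- a) logn b c)%N; last exact: dvd_logn.
  rewrite count_mem_sum; apply: eq_big_seq => c /aA/A_cases[|[e _ ->]].
    rewrite inE => /andP[c_pr _].
    by rewrite logn_prime // eq_sym (inj_eq val_inj).
  rewrite phiE lognM ?prime_gt0 // !logn_prime //.
  have := small_large (inl e.1) _ bL; have := small_large (inr e.2) _ bL.
  rewrite -!(inj_eq val_inj) ![_ == val b]eq_sym => /negbTE -> /negbTE ->.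
  by case: eqP => // eb; have := phi_notin_L e; rewrite (_ : phi e = b) ?bL //; apply: val_inj.
have -> : count_mem (phi e) a = (\sum_(c <- a) delta c e.1 e.2)%N.
  by rewrite count_mem_sum; apply: eq_bigr => c _; rewrite /delta ie -surjective_pairing.
apply: (weights_dvd3 inc (fun x y => \sum_(c <- a) delta c x y)%N inc_c4 inc_c6).
- move=> x1 y1; apply: contraTT => /negbTE i1.
  by rewrite big1 // => c _; rewrite /delta i1.
- move=> x1; rewrite exchange_big /=.
  by rewrite (eq_big_seq _ (fun c cA => sum_delta_row c x1 (aA c cA))).
- move=> y1; rewrite exchange_big /=.
  by rewrite (eq_big_seq _ (fun c cA => sum_delta_col c y1 (aA c cA))).
- under eq_bigr do rewrite exchange_big /=.
  rewrite exchange_big /= big_seq.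
  apply: (@leq_ltn_trans (\sum_(c <- a | c \in (a : seq _)) 1)%N).
    by apply: leq_sum => c ca; apply: sum_delta; exact: aA.
  by rewrite -big_seq sum1_size size_tuple.
Qed.

(** A trades the small primes for one product per edge; the additive form avoids truncated
    subtraction. *)
Lemma incidence_set_card :
  (prime_count n + #|[set e : X * Y | inc e.1 e.2]%SET| = #|A| + #|small_primes n|)%N.
Proof.
have disj : L :&: C = finset.set0.
  apply/finset.setP => c; rewrite [RHS]inE; apply/negP; rewrite inE.
  by case/andP=> cL /imsetP[e _ ce]; have := phi_notin_L e; rewrite -ce cL.
rewrite /A cardsU disj cards0 subn0 card_imset //.
have -> : prime_count n = (#|small_primes n| + #|L|)%N.
  rewrite prime_countE -(cardsID (small_primes n) [set p : 'I_n.+1 | prime p]%SET).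
  congr (_ + _)%N; apply: eq_card => p; rewrite !inE; case: (prime p); rewrite ?andbF //=.
  by rewrite -ltnNge andbT.
by rewrite [RHS]addnC addnA.
Qed.

End LowerBound.

Lemma max_size_ge {n : nat} (F : finFieldType) : (2 * #|F| ^ 3 <= #|small_primes n|)%N ->
  (prime_count n + #|F| ^ 4 <= max_size 9 3 n + #|small_primes n|)%N.
Proof.
move=> Fn.
have [|g g_inj gS] := @injection_into ((F * F * F) + (F * F * F))%type _ (small_primes n).
  by apply: leq_trans Fn; rewrite card_sum !card_prod addnn -mul2n !expnS expn0 muln1 !mulnA.
rewrite -card_incident (incidence_set_card incident g g_inj gS) leq_add2r.
apply: leq_bigmax_cond; apply/asboolP.
exact: (incidence_set_admissible incident incident_c4_free incident_c6_free g g_inj gS).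
Qed.

(** * Explicit estimates and the choice of the field *)

Lemma ln2_ge {R : realType} : 1 / 2 <= ln 2 :> R.
Proof.
rewrite -(expRK (1 / 2 : R)) ler_ln ?posrE ?expR_gt0 //.
have := expR_ge1Dx (- (1 / 2) : R).
have p := expR_gt0 (1 / 2 : R); rewrite expRN => h.
have := ler_wpM2r (ltW p) h; rewrite mulVf ?gt_eqF //; lra.
Qed.

Lemma trunc_log2_le {R : realType} (n : nat) : (0 < n)%N ->
  (trunc_log 2 n)%:R <= 2 * ln n%:R :> R.
Proof.
move=> n0; set k := trunc_log 2 n.
have h : ln (2 ^+ k) <= ln n%:R :> R.
  by rewrite ler_ln ?posrE ?exprn_gt0 ?ltr0n // -natrX ler_nat trunc_logP.
rewrite lnXn // -[_ *+ k]mulr_natl in h.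
by have := ler_wpM2l (ler0n R k) (@ln2_ge R); lra.
Qed.

(** Chebyshev's bound in squared form. For the largest m with (2 m)^2 <= n, m / 2 <= m ln 2 <= v ln
    (2 m) <= v ln n / 2, while n < (2 m + 2)^2 <= 16 m^2. *)
Lemma le_small_primes_ln {R : realType} {n : nat} : (4 <= n)%N ->
  n%:R <= 16 * (#|small_primes n|%:R * ln n%:R) ^+ 2 :> R.
Proof.
move=> n4; set v := #|_|.
have exm : exists m, (m.*2 ^ 2 <= n)%N by exists 0%N.
have mbound m : (m.*2 ^ 2 <= n)%N -> (m <= n)%N.
  apply: leq_trans; rewrite -addnn expnS expn1; nia.
case: (ex_maxnP exm mbound) => m mn mmax.
have m0 : (0 < m)%N by apply: mmax.
have nm : (n < m.+1.*2 ^ 2)%N.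
  by rewrite ltnNge; apply/negP => /mmax; rewrite ltnn.
have n0 : (0 < n)%N by apply: leq_trans n4.
have l0 : 0 <= ln n%:R :> R by rewrite ln_ge0 // ler1n.
have vm : m%:R * ln 2 <= v%:R * ln (m.*2)%:R :> R.
  have := expn2_le_small_primes m0 mn; rewrite -(ler_nat R) !natrX => h.
  rewrite !mulr_natl -!lnXn ?ltr0n ?double_gt0 //.
  by rewrite ler_ln ?posrE ?exprn_gt0 ?ltr0n ?double_gt0.
have lm : 2 * ln (m.*2)%:R <= ln n%:R :> R.
  rewrite mulr_natl -lnXn ?ltr0n ?double_gt0 // ler_ln ?posrE ?exprn_gt0 ?ltr0n ?double_gt0 //.
  by rewrite -natrX ler_nat.
have h1 := ler_wpM2l (ler0n R v) lm.
have h2 := ler_wpM2l (ler0n R m) (@ln2_ge R).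
have h3 : m%:R <= v%:R * ln n%:R :> R by lra.
apply: le_trans (_ : (16 * m ^ 2)%:R <= _).
  by rewrite ler_nat; apply: leq_trans (ltnW nm) _; rewrite -addnn !expnS !expn0; nia.
by rewrite natrM natrX ler_pM2l // ler_pXn2r ?nnegrE // (le_trans _ h3).
Qed.

(** With y = n^(1/4), ln n <= 4 y turns Chebyshev's bound into y^2 <= 256 v^2; then v < 2^16 would
    give y^2 < 2^40 and n < 2^80. *)
Lemma small_primes_ge {R : realType} {n : nat} :
  2 ^+ 80 <= n%:R :> R -> (2 ^ 16 <= #|small_primes n|)%N.
Proof.
move=> n80.
have n4 : (4 <= n)%N.
  rewrite -(ler_nat R); apply: le_trans n80.
  have -> : 4%:R = 2 ^+ 2 :> R by rewrite expr2; lra.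
  by apply: ler_weXn2l => //; lra.
have n0 : 0 < n%:R :> R by rewrite ltr0n; apply: leq_trans n4.
pose y : R := n%:R `^ (1 / 4).
have y0 : 0 < y by rewrite powR_gt0.
have y4 : n%:R = y ^+ 4.
  by rewrite -powR_mulrn ?powR_ge0 // -powRrM mul1r mulVf // powRr1 // ltW.
have ly : ln n%:R <= 4 * y.
  by have := ln_sublinear y0; rewrite /y ln_powR; lra.
have l0 : 0 <= ln n%:R :> R by rewrite ln_ge0 // ler1n (leq_trans _ n4).
have := le_small_primes_ln (R := R) n4; set v := #|_| => h.
have h1 : y ^+ 4 <= 16 * (v%:R * (4 * y)) ^+ 2.
  rewrite -y4; apply: le_trans h _; rewrite ler_pM2l // ler_pXn2r ?nnegrE ?mulr_ge0 ?ler0n ?(ltW y0) //.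
  by rewrite ler_wpM2l.
have h2 : y ^+ 2 <= 256 * v%:R ^+ 2.
  have y2 : 0 < y ^+ 2 by rewrite exprn_gt0.
  by rewrite -(ler_pM2r y2); lra.
rewrite leqNgt; apply/negP => v16.
have v16' : v%:R < 2 ^+ 16 :> R by rewrite -natrX ltr_nat.
have : v%:R ^+ 2 < (2 ^+ 16) ^+ 2 :> R by rewrite ltr_pXn2r ?nnegrE ?ler0n ?exprn_ge0.
rewrite -exprM => v32.
have e8 : 256 = 2 ^+ 8 :> R by rewrite !exprS expr0; lra.
have h3 : y ^+ 2 < 2 ^+ 40.
  by apply: le_lt_trans h2 _; rewrite e8 (exprD _ 8 32) ltr_pM2l // exprn_gt0.
have : (y ^+ 2) ^+ 2 < (2 ^+ 40) ^+ 2.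
  by rewrite ltr_pXn2r ?nnegrE ?exprn_ge0 // ltW.
by rewrite -!exprM -y4 ltNge n80.
Qed.

(** Take q = 2^k with k maximal for 2 q^3 <= v, so that v <= 16 q^3. The size of v gives k >= 5,
    whence v <= q^4 / 2: giving up the small primes costs at most half of the edges gained. *)
Lemma max_size_ge_exp {n : nat} : (2 ^ 16 <= #|small_primes n|)%N ->
  exists q, (#|small_primes n| <= 16 * q ^ 3)%N /\
    (2 * prime_count n + q ^ 4 <= 2 * max_size 9 3 n)%N.
Proof.
set v := #|_| => v16; set k := trunc_log 8 v./2.
have v0 : (0 < v)%N by apply: leq_trans v16; rewrite expn_gt0.
have v2 : (8 ^ 5 <= v./2)%N.
  by rewrite geq_half_double -mul2n (_ : 8 = 2 ^ 3)%N // -expnM -expnS.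
have v20 : (0 < v./2)%N by apply: leq_trans v2; rewrite expn_gt0.
have k5 : (5 <= k)%N by apply: trunc_log_max.
have lo : (8 ^ k <= v./2)%N by apply: trunc_logP.
have hi : (v./2 < 8 ^ k.+1)%N by apply: trunc_log_ltn.
have [F _ cF] := PrimePowerField (isT : prime 2) (ltn_trans (ltn0Sn 3) k5).
have q3 : (#|F| ^ 3 = 8 ^ k)%N by rewrite cF -expnM mulnC expnM.
have q32 : (32 <= #|F|)%N by rewrite cF (_ : 32 = 2 ^ 5)%N // leq_exp2l.
exists #|F|; rewrite q3.
have vle : (v <= 16 * 8 ^ k)%N.
  by rewrite expnS -q3 in hi *; have := odd_double_half v; rewrite -addnn; case: (odd v); lia.
split=> //.
have Fv : (2 * #|F| ^ 3 <= v)%N.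
  by rewrite q3; have := odd_double_half v; rewrite -addnn; lia.
have := max_size_ge F Fv; rewrite -/v => h.
have q4 : (#|F| ^ 4 = #|F| * 8 ^ k)%N by rewrite expnS q3.
have : (32 * 8 ^ k <= #|F| * 8 ^ k)%N by rewrite leq_mul2r q32 orbT.
by rewrite q4 in h *; lia.
Qed.

(** * The two asymptotic bounds *)

Theorem theorem10 (R : realType) :
  vinogradov
    (fun n : nat => n%:R `^ (2 / 3) / (ln n%:R) `^ (4 / 3) : R)
    (fun n : nat => (max_size 9 3 n)%:R - (prime_count n)%:R)
  /\
  vinogradov
    (fun n : nat => (max_size 9 3 n)%:R - (prime_count n)%:R : R)
    (fun n : nat => n%:R `^ (2 / 3) * ln n%:R).
Proof.
split.
  (* The constant is twice 256: n^(2/3) is at most 256 q^4 (ln n)^(4/3), and q^4 is at most twice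
     the excess over pi(n). *)
  exists 512 => //; near=> n.
  have n80 : 2 ^+ 80 <= n%:R :> R by near: n; exact: nbhs_infty_ger.
  have n4 : (4 <= n)%N by near: n; exact: nbhs_infty_ge.
  have [q [vq mq]] := max_size_ge_exp (small_primes_ge n80).
  have l0 : 0 < ln n%:R :> R by rewrite ln_gt0 // ltr1n (leq_trans _ n4).
  rewrite ler_pdivrMr ?powR_gt0 //.
  have nq : n%:R <= (16 * q%:R ^+ 2) ^+ 3 * ln n%:R ^+ 2 :> R.
    apply: le_trans (le_small_primes_ln n4) _.
    have -> : (16 * q%:R ^+ 2) ^+ 3 * ln n%:R ^+ 2 =
      16 * ((16 * q ^ 3)%:R * ln n%:R) ^+ 2 :> R by rewrite natrM natrX; ring.
    rewrite ler_pM2l // ler_pXn2r ?nnegrE ?mulr_ge0 ?ler0n ?(ltW l0) //.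
    by rewrite ler_wpM2r ?ler_nat // ltW.
  have q0 : 0 <= 16 * q%:R ^+ 2 :> R by rewrite mulr_ge0 ?exprn_ge0.
  have h : n%:R `^ (2 / 3) <= 256 * q%:R ^+ 4 * ln n%:R `^ (4 / 3) :> R.
    rewrite (_ : 256 * q%:R ^+ 4 = (16 * q%:R ^+ 2) ^+ 2); last by ring.
    move: nq q0; set Q := 16 * q%:R ^+ 2 => nq q0.
    apply: le_trans (ge0_ler_powR _ _ _ nq) _.
    - by lra.
    - by rewrite nnegrE.
    - by rewrite nnegrE mulr_ge0 ?exprn_ge0 // ltW.
    rewrite powRM ?exprn_ge0 // ?(ltW l0) // -!powR_mulrn ?(ltW l0) // -!powRrM.
    rewrite (_ : 3%:R * (2 / 3) = 2%:R :> R); last by field.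
    rewrite (_ : 2%:R * (2 / 3) = 4 / 3 :> R); last by field.
    by [].
  apply: le_trans h _; rewrite ler_wpM2r ?powR_ge0 //.
  move: mq; rewrite -(ler_nat R) natrD natrX !natrM; lra.
(* With k the binary logarithm, 2 + 5 (k + 1) <= 7 + 10 ln n <= 17 ln n, by ln n >= 1. *)
exists 17 => //; near=> n.
have n4 : (4 <= n)%N by near: n; exact: nbhs_infty_ge.
have n0 : (0 < n)%N by apply: leq_trans n4.
have l1 : 1 <= ln n%:R :> R.
  apply: le_trans (_ : ln (2 ^+ 2) <= _).
    by rewrite lnXn //; have := @ln2_ge R; lra.
  by rewrite ler_ln ?posrE ?exprn_gt0 ?ltr0n // -natrX ler_nat.
have := max_size_le (R := R) n0; have := trunc_log2_le (R := R) n n0.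
rewrite -natr1.
set k := (trunc_log 2 n)%:R; set T := n%:R `^ _ => kl mx.
have T0 : 0 <= T by exact: powR_ge0.
rewrite lerBlDl; apply: le_trans mx _; rewrite lerD2l [T * _]mulrC mulrA ler_wpM2r //.
lra.
Unshelve. all: by end_near.
Qed.
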